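(* Let $(R,pR)$ be a discrete valuation domain with valuation $\mathsf{v}$ and finite residue field. Let $f\in R[x]$ be a primitive, non-constant polynomial with $n:=\mathsf{v}(\operatorname{d}(f))\in\mathbb{N}$ (so $n\ge1$), and assume that $f$ is not a proper power of another polynomial in $R[x]$ (i.e. $f$ is not associated to $h^k$ for any $h\in R[x]$ and integer $k\ge 2$). Then $\frac{f}{p^n}$ is absolutely irreducible in $\operatorname{Int}(R)$ if and only if $\operatorname{fdk}(f)=\mathbf{0}$.
   Context: $(R,pR)$ is a discrete valuation domain with valuation $\mathsf{v}$, finite residue field, and quotient field $K$. $\operatorname{Int}(R)=\{F\in K[x]\mid F(R)\subseteq R\}$. For $f\in R[x]$, $\operatorname{d}(f)=\gcd(f(a)\mid a\in R)$, so $\mathsf{v}(\operatorname{d}(f))=\min_{a\in R}\mathsf{v}(f(a))$. Primitive means the coefficients generate $R$. An irreducible divisor set $\mathcal{P}$ of $f$ is a set of representatives of the associate classes of irreducible divisors of $f$ in $R[x]$. $\mathcal{W}(f)=\{a\in R\mid \mathsf{v}(f(a))=\mathsf{v}(\operatorname{d}(f))\}$, and $$\operatorname{fdk}(f)=\Big\{(u_g)_{g\in\mathcal{P}}\in\mathbb{Q}^{\mathcal{P}}\ \Big|\ \forall a\in\mathcal{W}(f):\ \textstyle\sum_{g\in\mathcal{P}}u_g\,\mathsf{v}(g(a))=0\Big\}$$ (whether it is zero does not depend on the choice of $\mathcal{P}$). An irreducible element $r$ of a commutative ring is absolutely irreducible if for every $k\in\mathbb{N}$ every factorization of $r^k$ into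 irreducibles is essentially the same as $r\cdots r$ (same number of factors, pairwise associated after reindexing). *)

(* Defs.v *)
From HB Require Import structures.
From mathcomp Require Import all_boot all_order all_algebra.
From mathcomp Require Import fraction.
Set Implicit Arguments. Unset Strict Implicit. Unset Printing Implicit Defensive.
Import Order.TTheory GRing.Theory Num.Theory.
Local Open Scope ring_scope.

Section InSubring.
Variables (A : comUnitRingType) (S : A -> Prop).

Definition unitIn (u : A) : Prop := S u /\ exists w, S w /\ u * w = 1.
Definition dvdIn (a b : A) : Prop := exists c, S c /\ b = a * c.
Definition assocIn (a b : A) : Prop := exists u, unitIn u /\ a = u * b.
Definition irredIn (r : A) : Prop :=
  [/\ S r, r != 0, ~ unitIn r &
      forall a b, S a -> S b -> r = a * b -> unitIn a \/ unitIn b].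
Definition abs_irredIn (r : A) : Prop :=
  irredIn r /\
  forall (k : nat) (s : seq A), (forall x, x \in s -> irredIn x) ->
    \prod_(x <- s) x = r ^+ k ->
    size s = k /\ (forall x, x \in s -> assocIn x r).
End InSubring.

Definition allR (T : Type) : T -> Prop := fun _ => True.

(* (R, pR) is a discrete valuation domain with uniformizer p and valuation v
   (v is the valuation on nonzero elements). *)
Definition dvr (R : idomainType) (p : R) (v : R -> nat) : Prop :=
  [/\ p != 0, p \isn't a GRing.unit &
      forall a : R, a != 0 -> exists u, u \is a GRing.unit /\ a = u * p ^+ v a].

Definition finite_residue (R : idomainType) (p : R) : Prop :=
  exists s : seq R, forall a : R, exists2 b, b \in s & exists c, a - b = p * c.

Definition IntR (R : idomainType) (F : {poly {fraction R}}) : Prop :=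
  forall a : R, exists b : R, F.[FracField.tofrac a] = FracField.tofrac b.

Definition primitive (R : idomainType) (f : {poly R}) : Prop :=
  exists c : nat -> R, \sum_(i < size f) c i * f`_i = 1.

(* v(d(f)) = n, i.e. min_{a in R} v(f(a)) = n (with v(0) = infinity) *)
Definition vd_eq (R : idomainType) (v : R -> nat) (f : {poly R}) (n : nat) : Prop :=
  (exists a : R, f.[a] != 0 /\ v f.[a] = n) /\
  (forall a : R, f.[a] != 0 -> (n <= v f.[a])%N).

(* W(f) = { a in R | v(f(a)) = v(d(f)) }, where n = v(d(f)) *)
Definition inW (R : idomainType) (v : R -> nat) (f : {poly R}) (n : nat) (a : R) : Prop :=
  f.[a] != 0 /\ v f.[a] = n.

Definition irr_div_set (R : idomainType) (f : {poly R}) (P : seq {poly R}) : Prop :=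
  [/\ forall g, g \in P -> irredIn (@allR _) g /\ dvdIn (@allR _) g f,
      forall g, irredIn (@allR _) g -> dvdIn (@allR _) g f ->
        exists i : 'I_(size P), assocIn (@allR _) g P`_i &
      forall i j : 'I_(size P), assocIn (@allR _) P`_i P`_j -> i = j].

Definition fdk_zero (R : idomainType) (v : R -> nat) (f : {poly R}) (n : nat)
    (P : seq {poly R}) : Prop :=
  forall u : 'I_(size P) -> rat,
    (forall a : R, inW v f n a ->
       \sum_(i < size P) u i * (v (P`_i).[a])%:R = 0) ->
    forall i, u i = 0.

(* Main.v *)
Require Import Defs.
From HB Require Import structures.
From mathcomp Require Import all_boot all_order all_algebra.
From mathcomp Require Import fraction.
From mathcomp Require Import zify.
From Stdlib Require Import Classical.
Import Order.TTheory GRing.Theory Num.Theory.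
Local Open Scope ring_scope.

Set Implicit Arguments. Unset Strict Implicit. Unset Printing Implicit Defensive.

(** Write [f = c * prod_i g_i ^ m_i] with pairwise non-associated irreducible
    [g_i]; by Gauss's lemma these stay irreducible and non-associated over the
    fraction field, so a divisor [x] of a power of [F = f / p^n] in [Int(R)] is
    a scalar times [prod_i g_i ^ a_i].  On [W(f)] the values of [F], hence those
    of [x], are units, so [sum_i a_i v(g_i(w))] is a constant [e] for [w] in
    [W(f)], whereas [sum_i m_i v(g_i(w)) = n].  If [fdk(f) = 0] this forces
    [n a_i = e m_i], and since [f] is not a proper power [x] is associated to a
    power of [F].  Conversely, an integral vector [z] in [fdk(f)] lets one replace
    the exponents [N m_i] by [N m_i + z_i] and [N m_i - z_i]: for large [N] both
    products, divided by [p^(N n)], remain in [Int(R)] and multiply to [F^(2N)] up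
    to a unit; if they are associated to powers of [F], then [z = 0]. *)

(** * Products of powers of a finite family *)

Definition powprod (A : comNzRingType) (I : finType) (g : I -> A) (a : I -> nat) : A :=
  \prod_i g i ^+ a i.

Section PowProd.
Variables (A : comNzRingType) (I : finType) (g : I -> A).

Lemma eq_powprod a b : a =1 b -> powprod g a = powprod g b.
Proof. by move=> eq_ab; apply: eq_bigr => i _; rewrite eq_ab. Qed.

Lemma powprodD a b : powprod g (fun i => a i + b i)%N = powprod g a * powprod g b.
Proof. by rewrite -big_split; apply: eq_bigr => i _; rewrite exprD. Qed.

Lemma powprodX a k : powprod g (fun i => k * a i)%N = powprod g a ^+ k.
Proof. by rewrite -prodrXl; apply: eq_bigr => i _; rewrite mulnC exprM. Qed.

Lemma powprod0 : powprod g (fun=> 0%N) = 1.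
Proof. by rewrite /powprod big1. Qed.

Lemma powprod_delta j : powprod g (fun i => (i == j) : nat) = g j.
Proof.
rewrite /powprod (bigD1 j) //= eqxx expr1 big1 ?mulr1 // => i /negPf ->.
by rewrite expr0.
Qed.

End PowProd.

Lemma rmorph_powprod (A B : comNzRingType) (h : {rmorphism A -> B}) (I : finType)
    (g : I -> A) a : h (powprod g a) = powprod (h \o g) a.
Proof. by rewrite rmorph_prod; apply: eq_bigr => i _; rewrite rmorphXn. Qed.

(** * Products of powers of irreducible polynomials *)

Section CoprimePowProd.
Variables (K : fieldType) (I : finType) (g : I -> {poly K}).
Hypothesis g_irr : forall i, irreducible_poly (g i).
Hypothesis g_ndvd : forall i j, g i %| g j -> i = j.

Lemma powprod_neq0 a : powprod g a != 0.
Proof. by apply/prodf_neq0 => i _; rewrite expf_neq0 ?irredp_neq0. Qed.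

Lemma irred_dvdp_mul (q h h' : {poly K}) :
  irreducible_poly q -> q %| h * h' -> (q %| h) || (q %| h').
Proof.
move=> q_irr; case: (boolP (q %| h)) => //= qh.
by rewrite Gauss_dvdpr // irreducible_poly_coprime.
Qed.

(** The factors [g j] with [j != i] are coprime to [g i], so [g i ^+ a i] already divides
    [g i ^+ b i]. *)
Lemma dvdp_powprod_le a b : powprod g a %| powprod g b -> forall i, (a i <= b i)%N.
Proof.
move=> ab i.
have: g i ^+ a i %| powprod g b.
  by apply: dvdp_trans ab; rewrite /powprod (bigD1 i) //= dvdp_mulr.
rewrite /powprod (bigD1 i) //= Gauss_dvdpl; last first.
  apply: coprimep_expl; apply: (big_ind (coprimep (g i))).
  - by rewrite coprimep1.
  - by move=> x y cx cy; rewrite coprimepMr cx.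
  - move=> j ji; apply: coprimep_expr; rewrite irreducible_poly_coprime //.
    by apply/negP => /g_ndvd eq_ij; rewrite eq_ij eqxx in ji.
by rewrite dvdp_Pexp2l //; case: (g_irr i).
Qed.

Lemma powprod_inj c a b : c != 0 -> powprod g a = c *: powprod g b -> a =1 b.
Proof.
move=> c0 eq_ab i; apply/eqP; rewrite eqn_leq !dvdp_powprod_le //.
  by rewrite eq_ab dvdpZr.
by rewrite eq_ab dvdpZl.
Qed.

(** Unique factorization by induction on the total exponent: as long as some [b j] is positive, one
    copy of [g j] can be cancelled from either [h] or its cofactor. *)
Lemma dvdp_powprodP (h : {poly K}) b : h %| powprod g b ->
  exists a c, c != 0 /\ h = c *: powprod g a.
Proof.
have [s] := ubnP (\sum_i b i)%N; elim: s h b => // s IH h b lt_bs hb.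
case: (altP (@eqP _ (\sum_i b i)%N 0%N)) => [/eqP|].
  rewrite sum_nat_eq0 => /forallP b0.
  have {}hb : h %| 1.
    rewrite -(powprod0 g); apply: dvdp_trans hb _.
    by rewrite (eq_powprod g (b := fun=> 0%N)) // => i; apply/eqP/b0.
  have /size_poly1P [c c0 ->] : size h == 1%N by rewrite -dvdp1.
  by exists (fun=> 0%N), c; rewrite powprod0 alg_polyC.
rewrite sum_nat_eq0 negb_forall => /existsP[j]; rewrite /= -lt0n => bj.
pose b' i := (b i - (i == j))%N.
have b'E : b =1 (fun i => b' i + (i == j))%N.
  by move=> i; rewrite /b' subnK //; case: eqP => [->|].
have sb' : (\sum_i b' i < s)%N.
  rewrite (eq_bigr _ (fun i _ => b'E i)) big_split /= in lt_bs.
  rewrite (bigD1 (I := I) (P := predT) j (F := fun i => nat_of_bool (i == j))) //= in lt_bs.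
  by rewrite eqxx /= in lt_bs; lia.
case/dvdpP: hb => h' eq_h.
rewrite (eq_powprod g b'E) powprodD powprod_delta in eq_h.
have: g j %| h * h' by rewrite mulrC -eq_h dvdp_mulIr.
(* If [g j] divides [h], the exponent vector found for the quotient gains one at [j]; if it divides
   the cofactor, [h] itself divides the smaller product. *)
case/(irred_dvdp_mul (g_irr j))/orP => /dvdpP[q eq_q].
  have qb : q %| powprod g b'.
    apply/dvdpP; exists h'; apply: (mulIf (irredp_neq0 (g_irr j))).
    by rewrite eq_h eq_q mulrA.
  have [a [c [c0 qE]]] := IH _ _ sb' qb.
  exists (fun i => a i + (i == j))%N, c; split=> //.
  by rewrite eq_q qE powprodD powprod_delta scalerAl.
apply: IH sb' _; apply/dvdpP; exists q.
apply: (mulIf (irredp_neq0 (g_irr j))).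
by rewrite eq_h eq_q mulrAC.
Qed.

End CoprimePowProd.

(** * Discrete valuation domains and Gauss's lemma *)

Section DVR.
Variables (R : idomainType) (p : R) (v : R -> nat).
Hypothesis p_dvr : dvr p v.

Local Notation "x %:F" := (@FracField.tofrac R x).
Local Notation "g ^F" := (map_poly (@FracField.tofrac R) g) (at level 1, format "g ^F").

Let p0 : p != 0. Proof. by case: p_dvr. Qed.

Lemma dvr_nonunitP (x : R) : x \isn't a GRing.unit <-> exists y, x = p * y.
Proof.
case: p_dvr => _ pN Rv; split=> [xN|[y ->]]; last by rewrite unitrM (negPf pN).
have [->|x0] := eqVneq x 0; first by exists 0; rewrite mulr0.
have [u [uU xE]] := Rv _ x0; case: (v x) xE => [|k] xE.
  by rewrite xE expr0 mulr1 uU in xN.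
by exists (u * p ^+ k); rewrite xE exprS mulrCA.
Qed.

(** If [j < i], cancelling [p ^+ j] would make the unit [w] a multiple of [p]. *)
Lemma dvr_unit_dvd (u w : R) i j : w \is a GRing.unit ->
  u * p ^+ i = w * p ^+ j -> (i <= j)%N.
Proof.
move=> wU; rewrite leqNgt => eq_ij; apply/negP => lt_ji.
have := eq_ij; rewrite -(subnK lt_ji) addnS -addSn exprD mulrA.
move/(mulIf (expf_neq0 _ p0)) => wE.
suff /negP[] : w \isn't a GRing.unit by [].
by apply/dvr_nonunitP; exists (u * p ^+ (i - j.+1)); rewrite -wE exprS mulrCA.
Qed.

(** The definition [dvr] only says that [v x] is some exponent that works. Uniqueness of this
    exponent is what makes [v] computable, and hence additive on products. *)
Lemma dvr_val_uniq (x u : R) k : u \is a GRing.unit -> x = u * p ^+ k -> v x = k.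
Proof.
move=> uU xE; have x0 : x != 0.
  rewrite xE mulf_neq0 ?expf_neq0 //.
  by apply: contraTneq uU => ->; rewrite unitr0.
case: p_dvr => _ _ /(_ _ x0)[w [wU xE']].
have eq_p : w * p ^+ v x = u * p ^+ k by rewrite -xE'.
by apply/eqP; rewrite eqn_leq (dvr_unit_dvd uU eq_p) (dvr_unit_dvd wU (esym eq_p)).
Qed.

Lemma dvr_valM (x y : R) : x != 0 -> y != 0 -> v (x * y) = (v x + v y)%N.
Proof.
case: p_dvr => _ _ Rv /Rv[u [uU {1}->]] /Rv[w [wU {1}->]].
apply: (@dvr_val_uniq _ (u * w)); first by rewrite unitrM uU.
by rewrite mulrACA exprD.
Qed.

Lemma dvr_val_unit (u : R) : u \is a GRing.unit -> v u = 0%N.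
Proof. by move=> uU; apply: (dvr_val_uniq uU); rewrite mulr1. Qed.

Lemma dvr_valX (x : R) k : x != 0 -> v (x ^+ k) = (k * v x)%N.
Proof.
move=> x0; elim: k => [|k IH]; first by rewrite dvr_val_unit ?unitr1.
by rewrite exprS dvr_valM ?expf_neq0 // IH mulSn.
Qed.

Lemma dvr_val_prod (I : finType) (g : I -> R) (a : I -> nat) :
  (forall i, g i != 0) -> v (powprod g a) = (\sum_i a i * v (g i))%N.
Proof.
move=> g0; suff [] : powprod g a != 0 /\ v (powprod g a) = (\sum_i a i * v (g i))%N by [].
apply: (big_ind2 (fun x k => x != 0 /\ v x = k)).
- by rewrite oner_neq0 dvr_val_unit ?unitr1.
- by move=> x k y l [x0 <-] [y0 <-]; rewrite mulf_neq0 ?dvr_valM.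
- by move=> i _; rewrite expf_neq0 ?dvr_valX.
Qed.

(** The bound is guarded by [x != 0] because [v 0] is arbitrary, while 0 is divisible by every power
    of [p]. *)
Lemma dvr_dvd_val (x : R) k : (x != 0 -> (k <= v x)%N) -> exists y, x = p ^+ k * y.
Proof.
have [->|x0] := eqVneq x 0; first by exists 0; rewrite mulr0.
case: p_dvr => _ _ /(_ _ x0)[w [wU xE]] /(_ isT) le_k.
by exists (w * p ^+ (v x - k)); rewrite mulrCA -exprD subnKC.
Qed.

(* Over a valuation ring, having a unit coefficient is the same as being primitive. *)
Definition unimodular (g : {poly R}) := exists i, g`_i \is a GRing.unit.

Lemma nonunimodularP (g : {poly R}) : ~ unimodular g <-> exists h, g = p *: h.
Proof.
split=> [|[h ->] [i]]; last first.
  by rewrite coefZ unitrM; case: p_dvr => _ /negPf ->.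
elim/poly_ind: g => [|g c IH] gN; first by exists 0; rewrite scaler0.
have [|h gE] := IH.
  by case=> i gi; apply: gN; exists i.+1; rewrite coefD coefMX coefC addr0.
have /dvr_nonunitP[d ->] : c \isn't a GRing.unit.
  by apply/negP => cU; apply: gN; exists 0%N; rewrite coefD coefMX coefC add0r.
by exists (h * 'X + d%:P); rewrite gE scalerDr scalerAl -[p *: d%:P]mul_polyC polyCM.
Qed.

Lemma primitive_unimodular (g : {poly R}) : primitive g -> unimodular g.
Proof.
case=> c sum1; apply: NNPP => /nonunimodularP[h gE].
suff /negP[] : (1 : R) \isn't a GRing.unit by exact: unitr1.
apply/dvr_nonunitP; exists (\sum_(i < size g) c i * h`_i).
by rewrite -sum1 mulr_sumr; apply: eq_bigr => i _; rewrite {2}gE coefZ mulrCA.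
Qed.

(** Gauss's lemma: with [i] and [j] the least indices of unit coefficients, the coefficient of the
    product at [i + j] is a unit plus a multiple of [p]. *)
Lemma unimodularM (g h : {poly R}) : unimodular g -> unimodular h -> unimodular (g * h).
Proof.
move=> gU hU; have [i gi imin] := ex_minnP gU; have [j hj jmin] := ex_minnP hU.
exists (i + j)%N; rewrite coefM.
have lt_i : (i < (i + j).+1)%N by rewrite ltnS leq_addr.
rewrite (bigD1 (Ordinal lt_i)) //= addKn.
set s := \sum_(_ < _ | _) _.
have [y ->] : exists y, s = p * y.
  rewrite /s; apply: (big_ind (fun x => exists y, x = p * y)).
  - by exists 0; rewrite mulr0.
  - by move=> x x' [y ->] [y' ->]; exists (y + y'); rewrite mulrDr.
  - move=> k; rewrite -val_eqE /= => ki; apply/dvr_nonunitP; rewrite unitrM negb_and.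
    have [lt_ki|le_ik] := ltnP k i.
      by apply/orP; left; apply/negP => /imin; rewrite leqNgt lt_ki.
    apply/orP; right; apply/negP => /jmin.
    by have := ltn_ord k; lia.
apply/negPn/negP => /dvr_nonunitP[z zE].
have /negP[] : g`_i * h`_j \isn't a GRing.unit.
  by apply/dvr_nonunitP; exists (z - y); rewrite mulrBr -zE addrK.
by rewrite unitrM gi.
Qed.

Lemma unimodularMl (g h : {poly R}) : unimodular (g * h) -> unimodular g.
Proof.
move=> ghU; apply: NNPP => /nonunimodularP[g' gE].
by apply/nonunimodularP: ghU; exists (g' * h); rewrite gE scalerAl.
Qed.

Lemma unimodularC (c : R) : unimodular c%:P -> c \is a GRing.unit.
Proof. by case=> -[|i]; rewrite coefC ?unitr0. Qed.

(** Each extraction of a factor [p] lowers the valuation of the leading coefficient by one, so the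
    process stops. *)
Lemma unimodular_part (g : {poly R}) : g != 0 ->
  exists c g', [/\ c != 0, unimodular g' & g = c *: g'].
Proof.
have [k] := ubnP (v (lead_coef g)); elim: k g => // k IH g lt_k g0.
have [gU|/nonunimodularP[h gE]] := classic (unimodular g).
  by exists 1, g; rewrite oner_neq0 scale1r.
have h0 : h != 0 by apply: contraNneq g0 => h0; rewrite gE h0 scaler0.
have [|c [g' [c0 g'U hE]]] := IH h _ h0.
  move: lt_k; rewrite gE lead_coefZ dvr_valM ?lead_coef_eq0 //.
  have -> : v p = 1%N by apply: (@dvr_val_uniq _ 1); rewrite ?unitr1 ?mul1r.
  by rewrite add1n ltnS.
by exists (p * c), g'; rewrite mulf_neq0 // gE hE scalerA.
Qed.

(** * Passage to the fraction field *)

Lemma frac_clear (x : {fraction R}) : exists a b, b != 0 /\ b%:F * x = a%:F.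
Proof.
elim/quotW: x => r; exists \n_r, \d_r; split; first exact: denom_ratioP.
unlock FracField.tofrac; rewrite -[LHS]FracField.pi_mul.
apply/eqmodP; rewrite /= FracField.equivfE /FracField.mulf.
by rewrite !numden_Ratio ?mulf_neq0 ?oner_neq0 ?denom_ratioP // !mul1r mulr1 mulrC.
Qed.

Lemma poly_clear (q : {poly {fraction R}}) : exists (g : {poly R}) b, b != 0 /\ b%:F *: q = g^F.
Proof.
elim/poly_ind: q => [|q c [g [b [b0 gE]]]].
  by exists 0, 1; rewrite oner_neq0 scaler0 rmorph0.
have [a [d [d0 dE]]] := frac_clear c.
exists (d *: g * 'X + (b * a)%:P), (d * b); rewrite mulf_neq0 //; split=> //.
rewrite rmorphD [X in _ = X + _]rmorphM /= map_polyX map_polyZ map_polyC /= !tofracM -dE.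
rewrite scalerDr scalerAl -gE scalerA -!mul_polyC -!polyCM.
by rewrite mulrCA mulrA.
Qed.

(** By symmetry [v y <= v x], and [p ^+ v y] cancels. A positive power of [p] left over would divide
    [g], against unimodularity. *)
Lemma unimodular_assoc (g h : {poly R}) x y : unimodular g -> unimodular h ->
  y != 0 -> x != 0 -> y *: g = x *: h ->
  exists u, u \is a GRing.unit /\ g = u *: h.
Proof.
wlog le_yx: g h x y / (v y <= v x)%N => [wl gU hU y0 x0 eq_gh|].
  have [/wl|/ltnW/wl] := leqP (v y) (v x); first by apply.
  move=> /(_ h g hU gU x0 y0 (esym eq_gh))[u [uU ->]].
  by exists u^-1; rewrite unitrV scalerA mulVr // scale1r.
move=> gU hU y0 x0; case: p_dvr => _ _ Rv.
have [w [wU yE]] := Rv _ y0; have [u [uU xE]] := Rv _ x0.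
rewrite yE xE -(subnK le_yx) exprD mulrA mulrC [u * _ * _]mulrC -!scalerA.
rewrite -!(mul_polyC (p ^+ v y)) => /mulfI eq_gh.
have {}eq_gh : g = w^-1 *: ((u * p ^+ (v x - v y)) *: h).
  by rewrite -scalerA -eq_gh ?polyC_eq0 ?expf_neq0 // scalerA mulVr // scale1r.
exists (w^-1 * u); split; first by rewrite unitrM unitrV wU.
case: (v x - v y)%N eq_gh => [|k] eq_gh; first by rewrite eq_gh mulr1 scalerA.
case: (iffRL (nonunimodularP _) _ gU); exists (w^-1 *: ((u * p ^+ k) *: h)).
by rewrite eq_gh !scalerA exprS [u * (p * _)]mulrCA [w^-1 * (p * _)]mulrCA.
Qed.

Lemma tofrac_inj : injective (@FracField.tofrac R).
Proof. by move=> x y /eqP; rewrite tofrac_eq => /eqP. Qed.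

Lemma size_frac (g : {poly R}) : size g^F = size g.
Proof. by rewrite size_map_inj_poly ?rmorph0 //; apply: tofrac_inj. Qed.

Lemma frac_poly_inj : injective (map_poly (@FracField.tofrac R)).
Proof. by apply: map_inj_poly; rewrite ?rmorph0 //; apply: tofrac_inj. Qed.

Lemma unimodular_neq0 (g : {poly R}) : unimodular g -> g != 0.
Proof. by case=> i gi; apply: contraTneq gi => ->; rewrite coef0 unitr0. Qed.

Lemma frac_unimodular_part (q : {poly {fraction R}}) : q != 0 ->
  exists c g, unimodular g /\ q = c *: g^F.
Proof.
move=> q0; have [g [b [b0 qE]]] := poly_clear q.
have bF0 : b%:F != 0 by rewrite tofrac_eq0.
have g0 : g != 0.
  apply: contra_neq q0 => g0; move: qE; rewrite g0 rmorph0 => /eqP.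
  by rewrite scaler_eq0 (negPf bF0) => /eqP.
have [c [g' [c0 g'U gE]]] := unimodular_part g0.
exists (b%:F^-1 * c%:F), g'; split=> //.
by rewrite -scalerA -map_polyZ /= -gE -qE scalerA mulVf // scale1r.
Qed.

Lemma frac_unimodular_assoc (g h : {poly R}) c : unimodular g -> unimodular h ->
  g^F = c *: h^F -> exists u, u \is a GRing.unit /\ g = u *: h.
Proof.
move=> gU hU gE; have [a [b [b0 ab]]] := frac_clear c.
have eq_gh : b *: g = a *: h.
  by apply: frac_poly_inj; rewrite !map_polyZ /= gE scalerA ab.
apply: (unimodular_assoc gU hU b0 _ eq_gh).
have: b *: g != 0 by rewrite -mul_polyC mulf_neq0 ?polyC_eq0 ?unimodular_neq0.
by rewrite eq_gh; apply: contraNneq => ->; rewrite scale0r.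
Qed.

Lemma unitIn_polyP (g : {poly R}) :
  unitIn (@allR _) g <-> exists u, u \is a GRing.unit /\ g = u%:P.
Proof.
split=> [[_ [w [_ gw]]]|[u [uU ->]]]; last first.
  by split=> //; exists u^-1%:P; rewrite -polyCM mulrV.
have: g \is a GRing.unit by apply/unitrPr; exists w.
by rewrite poly_unitE => /andP[/eqP sg gU]; exists g`_0; rewrite gU {1}(size1_polyC (eq_leq sg)).
Qed.

Lemma unimodular_nonconst (g : {poly R}) :
  unimodular g -> ~ unitIn (@allR _) g -> (1 < size g)%N.
Proof.
move=> gU gN; rewrite ltnNge; apply/negP => /size1_polyC gE; apply: gN.
by apply/unitIn_polyP; exists g`_0; split=> //; apply: unimodularC; rewrite -gE.
Qed.

(** Replacing both factors over the fraction field by their unimodular parts gives a unimodular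
    product, which equals [g] up to a unit of [R]. The factorization thus descends to [R[x]], where
    one factor must be a unit. *)
Lemma irreducible_frac (g : {poly R}) :
  unimodular g -> irredIn (@allR _) g -> irreducible_poly g^F.
Proof.
move=> gU [_ g0 gN g_irr]; split=> [|d d1 /dvdpP[e gE]].
  by rewrite size_frac unimodular_nonconst.
have: g^F != 0 by rewrite -size_poly_eq0 size_frac size_poly_eq0.
rewrite gE mulf_eq0 => /norP[e0 d0].
have [c [d' [d'U dE]]] := frac_unimodular_part d0.
have [c' [e' [e'U eE]]] := frac_unimodular_part e0.
have [|u [uU gE']] := @frac_unimodular_assoc g (e' * d') (c' * c) gU (unimodularM e'U d'U).
  by rewrite gE eE dE rmorphM /= -scalerAl -scalerAr scalerA.
have [//|//||/unitIn_polyP[w [wU eE']]|/unitIn_polyP[w [wU dE']]] := g_irr (u *: e') d'.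
- by rewrite gE' scalerAl.
- have: size (u *: e') = 1%N.
    by rewrite eE' size_polyC; case: eqP wU => // ->; rewrite unitr0.
  rewrite size_scale; last by apply: contraTneq uU => ->; rewrite unitr0.
  move=> se; rewrite -{1}[d]mul1r.
  apply: eqp_mulr; rewrite eqp_sym -size_poly_eq1 eE size_scale ?size_frac ?se //.
  by apply: contraNneq e0 => c0; rewrite eE c0 scale0r.
- case/negP: d1; rewrite dE dE' size_scale; last first.
    by apply: contraNneq d0 => c0; rewrite dE c0 scale0r.
  rewrite size_frac size_polyC; suff -> : w != 0 by [].
  by apply: contraTneq wU => ->; rewrite unitr0.
Qed.

(** * Integer-valued polynomials *)

Lemma IntRM (x y : {poly {fraction R}}) : IntR x -> IntR y -> IntR (x * y).
Proof.
move=> xI yI a; have [b xb] := xI a; have [c yc] := yI a.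
by exists (b * c); rewrite hornerM xb yc tofracM.
Qed.

Lemma IntRC (c : R) : IntR (c%:F)%:P.
Proof. by move=> a; exists c; rewrite hornerC. Qed.

Lemma IntRZ (c : R) (x : {poly {fraction R}}) : IntR x -> IntR (c%:F *: x).
Proof. by rewrite -mul_polyC => xI; apply: IntRM => //; apply: IntRC. Qed.

Lemma IntR_prod (s : seq {poly {fraction R}}) :
  (forall x, x \in s -> IntR x) -> IntR (\prod_(x <- s) x).
Proof.
move=> sI; rewrite big_seq; apply: (big_ind (@IntR R)) => //; last exact: IntRM.
by rewrite -[1]/(1%:F%:P); apply: IntRC.
Qed.

Lemma IntRX (x : {poly {fraction R}}) k : IntR x -> IntR (x ^+ k).
Proof.
move=> xI; elim: k => [|k IH]; last by rewrite exprS; apply: IntRM.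
by rewrite expr0 -[1]/(1%:F%:P); apply: IntRC.
Qed.

Lemma unit_tofrac_neq0 (u : R) : u \is a GRing.unit -> u%:F != 0.
Proof. by move=> uU; rewrite tofrac_eq0; apply: contraTneq uU => ->; rewrite unitr0. Qed.

(** Factors in Int(R) inherit a unit value at a point, and a constant with such a value is a unit.
    This makes the degree a termination measure for factorization in Int(R). *)
Definition unit_at (x : {poly {fraction R}}) (a : R) :=
  exists u, u \is a GRing.unit /\ x.[a%:F] = u%:F.

Lemma unit_atMl (x y : {poly {fraction R}}) a : IntR x -> IntR y -> unit_at (x * y) a -> unit_at x a.
Proof.
move=> xI yI [u [uU]]; have [b xb] := xI a; have [c yc] := yI a.
rewrite hornerM xb yc -tofracM => /eqP; rewrite tofrac_eq => /eqP bc.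
by exists b; split=> //; move: uU; rewrite -bc unitrM => /andP[].
Qed.

Lemma unit_atMr (x y : {poly {fraction R}}) a : IntR x -> IntR y -> unit_at (x * y) a -> unit_at y a.
Proof. by rewrite mulrC => xI yI; apply: unit_atMl. Qed.

Lemma unitIn_IntRP (x : {poly {fraction R}}) :
  unitIn (@IntR R) x <-> exists u, u \is a GRing.unit /\ x = (u%:F)%:P.
Proof.
split=> [[xI [w [wI xw]]]|[u [uU ->]]]; last first.
  split; first exact: IntRC.
  exists (u^-1%:F)%:P; split; first exact: IntRC.
  by rewrite -polyCM -tofracM mulrV.
have [|u [uU xu]] := unit_atMl (a := 0) xI wI.
  by exists 1; rewrite unitr1 xw hornerC.
exists u; split=> //; rewrite -xu.
have /eqP sx : size x == 1%N by rewrite -dvdp1 -xw dvdp_mulIl.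
by rewrite (size1_polyC (eq_leq sx)) hornerC.
Qed.

Lemma assocIn_IntRP (x y : {poly {fraction R}}) :
  assocIn (@IntR R) x y <-> exists u, u \is a GRing.unit /\ x = u%:F *: y.
Proof.
split=> [[w [/unitIn_IntRP[u [uU ->]] ->]]|[u [uU ->]]].
  by exists u; rewrite mul_polyC.
exists (u%:F)%:P; rewrite mul_polyC; split=> //.
by apply/unitIn_IntRP; exists u.
Qed.

Lemma unit_at_const (x : {poly {fraction R}}) a :
  (size x <= 1)%N -> unit_at x a -> unitIn (@IntR R) x.
Proof.
move=> /size1_polyC xE [u [uU]]; rewrite xE hornerC => x0.
by apply/unitIn_IntRP; exists u; rewrite x0.
Qed.

(** Every nonunit factor of [x] is nonconstant because its value at [a] is a unit, so a proper
    factorization lowers both degrees. The scalar [w] covers the case where [x] is itself a unit. *)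
Lemma IntR_factorization (x : {poly {fraction R}}) a : IntR x -> unit_at x a ->
  exists w s, [/\ w \is a GRing.unit, forall y, y \in s -> irredIn (@IntR R) y
                & x = w%:F *: \prod_(y <- s) y].
Proof.
have [k] := ubnP (size x); elim: k x => // k IH x lt_k xI xU.
have [/unitIn_IntRP[u [uU xE]]|xN] := classic (unitIn (@IntR R) x).
  by exists u, [::]; rewrite big_nil alg_polyC.
have [x_irr|xR] := classic (irredIn (@IntR R) x).
  by exists 1, [:: x]; rewrite unitr1 big_seq1 scale1r; split=> // y /[!inE] /eqP->.
have x0 : x != 0.
  by case: xU => u [/unit_tofrac_neq0 + xu]; apply: contraNneq => x0; rewrite -xu x0 horner0.
have [y [z [yI zI xE [yN zN]]]] : exists y z, [/\ IntR y, IntR z, x = y * z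
    & ~ unitIn (@IntR R) y /\ ~ unitIn (@IntR R) z].
  apply: NNPP => xNN; apply: xR; split=> // y z yI zI xE.
  apply: NNPP => /not_or_and yzN; apply: xNN.
  by exists y, z.
have yU : unit_at y a by apply: (unit_atMl yI zI); rewrite -xE.
have zU : unit_at z a by apply: (unit_atMr yI zI); rewrite -xE.
have sy : (1 < size y)%N by rewrite ltnNge; apply/negP => /unit_at_const/(_ yU).
have sz : (1 < size z)%N by rewrite ltnNge; apply/negP => /unit_at_const/(_ zU).
have sx : size x = (size y + size z).-1.
  by rewrite xE size_mul // -size_poly_gt0 ltnW.
have [|w1 [s1 [w1U s1I yE]]] := IH y _ yI yU; first by lia.
have [|w2 [s2 [w2U s2I zE]]] := IH z _ zI zU; first by lia.
exists (w1 * w2), (s1 ++ s2); split; first by rewrite unitrM w1U.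
  by move=> t; rewrite mem_cat => /orP[/s1I|/s2I].
by rewrite big_cat /= tofracM xE yE zE -scalerAl -scalerAr scalerA.
Qed.

Lemma assoc_prod (F : {poly {fraction R}}) s :
  (forall x, x \in s -> assocIn (@IntR R) x F) ->
  exists u, u \is a GRing.unit /\ \prod_(x <- s) x = u%:F *: F ^+ size s.
Proof.
elim: s => [|x s IH] sF; first by exists 1; rewrite unitr1 big_nil scale1r.
have [|u [uU sE]] := IH; first by move=> y ys; apply: sF; rewrite inE ys orbT.
have /assocIn_IntRP[w [wU xE]] := sF _ (mem_head x s).
exists (w * u); rewrite unitrM wU uU; split=> //.
by rewrite big_cons sE xE exprS tofracM -scalerAl -scalerAr scalerA.
Qed.

(** * Absolute irreducibility through divisors of powers *)

Section AbsIrred.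
Variables (F : {poly {fraction R}}) (a0 : R).
Hypothesis F_Int : IntR F.
Hypothesis F_unit : unit_at F a0.
Hypothesis F_nonconst : (1 < size F)%N.

Lemma exp_assoc_inj u k l : u \is a GRing.unit -> F ^+ k = u%:F *: F ^+ l -> k = l.
Proof.
move=> uU /(congr1 (fun q : {poly _} => (size q).-1)).
rewrite size_scale ?unit_tofrac_neq0 // !size_exp => /eqP.
by rewrite eqn_pmul2l; [move/eqP|rewrite -ltnS prednK // ltnW].
Qed.

Lemma unit_at_exp k : unit_at (F ^+ k) a0.
Proof.
by case: F_unit => u [uU Fu]; exists (u ^+ k); rewrite unitrX // horner_exp Fu tofracXn.
Qed.

Lemma exp_nonunit k : ~ unitIn (@IntR R) (F ^+ k.+1).
Proof.
case/unitIn_IntRP=> u [uU FE].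
by have: k.+1 = 0%N by apply: (@exp_assoc_inj u) => //; rewrite expr0 alg_polyC.
Qed.

Lemma IntR_irred_scale u x : u \is a GRing.unit ->
  irredIn (@IntR R) x -> irredIn (@IntR R) (u%:F *: x).
Proof.
move=> uU [xI x0 xN x_irr]; have uF0 := unit_tofrac_neq0 uU; split.
- exact: IntRZ.
- by rewrite scaler_eq0 negb_or uF0.
- case/unitIn_IntRP=> w [wU xE]; apply: xN; apply/unitIn_IntRP.
  exists (u^-1 * w); rewrite unitrM unitrV uU wU; split=> //.
  by rewrite tofracM polyCM mul_polyC -xE scalerA -tofracM mulVr // scale1r.
- move=> y z yI zI xE.
  have [|||/unitIn_IntRP[w [wU yE]]|] := x_irr (u^-1%:F *: y) z; rewrite ?IntRZ //; last by right.
  - exact: IntRZ.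
  - by rewrite -scalerAl -xE scalerA -tofracM mulVr // scale1r.
  left; apply/unitIn_IntRP; exists (u * w); rewrite unitrM uU wU; split=> //.
  by rewrite tofracM polyCM mul_polyC -yE scalerA -tofracM mulrV // scale1r.
Qed.

(* Reduces absolute irreducibility to a statement about arbitrary, not
   necessarily irreducible, divisors of the powers of [F]. *)
Lemma abs_irredIn_divisorsP : abs_irredIn (@IntR R) F <->
  forall k x y, IntR x -> IntR y -> x * y = F ^+ k ->
    exists u t, u \is a GRing.unit /\ x = u%:F *: F ^+ t.
Proof.
split=> [[F_irr F_abs] k x y xI yI xyE|F_div].
  have xyU := unit_at_exp k; rewrite -xyE in xyU.
  have [w1 [s1 [w1U s1I xE]]] := IntR_factorization xI (unit_atMl xI yI xyU).
  have [w2 [s2 [w2U s2I yE]]] := IntR_factorization yI (unit_atMr xI yI xyU).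
  have sF z : z \in s1 ++ s2 -> assocIn (@IntR R) z F.
    have: (w1 * w2)%:F *: \prod_(z <- s1 ++ s2) z = F ^+ k.
      by rewrite -xyE big_cat /= tofracM xE yE -scalerAl -scalerAr scalerA.
    have: forall z, z \in s1 ++ s2 -> irredIn (@IntR R) z.
      by move=> t; rewrite mem_cat => /orP[/s1I|/s2I].
    have wU : w1 * w2 \is a GRing.unit by rewrite unitrM w1U.
    (* Absolute irreducibility speaks of products equal to [F ^+ k] exactly, so the unit [w1 * w2]
       is absorbed into the first irreducible factor. *)
    case: (s1 ++ s2) => // h s sI; rewrite big_cons scalerAl => sE.
    have [||_ sF] := F_abs k ((w1 * w2)%:F *: h :: s); last 1 first.
    - rewrite inE => /orP[/eqP->|zs]; last by apply: sF; rewrite inE zs orbT.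
      have /assocIn_IntRP[u [uU hE]] := sF _ (mem_head _ _).
      apply/assocIn_IntRP; exists ((w1 * w2)^-1 * u); rewrite unitrM unitrV wU uU; split=> //.
      by rewrite tofracM -scalerA -hE scalerA -tofracM mulVr // scale1r.
    - move=> t; rewrite inE => /orP[/eqP->|ts]; last by apply: sI; rewrite inE ts orbT.
      by apply: IntR_irred_scale => //; apply: sI; rewrite mem_head.
    - by rewrite big_cons.
  have [|u [uU sE]] := @assoc_prod F s1; first by move=> z zs; apply: sF; rewrite mem_cat zs.
  exists (w1 * u), (size s1); rewrite unitrM w1U uU; split=> //.
  by rewrite xE sE scalerA tofracM.
split=> [|k s s_irr sE].
  split=> //; first by rewrite -size_poly_gt0 ltnW.
    exact: (@exp_nonunit 0).
  move=> x y xI yI FE.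
  have [u1 [t1 [u1U xE]]] := F_div 1%N x y xI yI (esym FE).
  have [u2 [t2 [u2U yE]]] := F_div 1%N y x yI xI (etrans (mulrC _ _) (esym FE)).
  (* Comparing degrees forces one of the two exponents to vanish, which makes that factor a unit. *)
  have: 1%N = (t1 + t2)%N.
    apply: (@exp_assoc_inj (u1 * u2)); first by rewrite unitrM u1U.
    by rewrite expr1 [LHS]FE xE yE tofracM exprD -scalerAl -scalerAr scalerA.
  case: t1 xE => [|t1] xE.
    by left; apply/unitIn_IntRP; exists u1; rewrite xE expr0 alg_polyC.
  case: t2 yE => [|t2] yE; last by lia.
  by right; apply/unitIn_IntRP; exists u2; rewrite yE expr0 alg_polyC.
have sF x : x \in s -> assocIn (@IntR R) x F.
  move=> xs; have [xI _ xN x_irr] := s_irr _ xs.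
  (* The irreducible [x] is associated to a power of [F]: exponent 0 would make it a unit, and
     exponent at least 2 would split it into two nonunits. *)
  have [||u [[|[|t]] [uU xE]]] := F_div k x (\prod_(y <- rem x s) y) xI.
  - by apply: IntR_prod => y /mem_rem /s_irr[].
  - by rewrite -sE (perm_big _ (perm_to_rem xs)) big_cons.
  - by case: xN; apply/unitIn_IntRP; exists u; rewrite xE expr0 alg_polyC.
  - by apply/assocIn_IntRP; exists u.
  have [|||/unitIn_IntRP[w [wU FE]]|/(@exp_nonunit t)//] := x_irr (u%:F *: F) (F ^+ t.+1).
  - exact: IntRZ.
  - exact: IntRX.
  - by rewrite xE exprS scalerAl.
  case: (@exp_nonunit 0); apply/unitIn_IntRP.
  exists (u^-1 * w); rewrite unitrM unitrV uU wU; split=> //.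
  by rewrite tofracM polyCM mul_polyC -FE scalerA -tofracM mulVr // scale1r.
split=> //; have [u [uU pE]] := assoc_prod sF.
by apply/esym/(@exp_assoc_inj u) => //; rewrite -sE.
Qed.

End AbsIrred.

(** * Exponent vectors of divisors *)

Section IrreducibleDivisors.
Variables (f : {poly R}) (P : seq {poly R}).
Hypothesis f_unimod : unimodular f.
Hypothesis P_irr : irr_div_set f P.

Local Notation g := (fun i : 'I_(size P) => P`_i).
Local Notation gK := (fun i : 'I_(size P) => (P`_i)^F).

Lemma irr_div_unimodular i : unimodular (g i).
Proof.
case: P_irr => /(_ (g i) (mem_nth _ (ltn_ord i)))[_ [c [_ fE]]] _ _.
by apply: (@unimodularMl _ c); rewrite -fE.
Qed.

Lemma irr_div_frac_irreducible i : irreducible_poly (gK i).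
Proof.
apply: irreducible_frac; first exact: irr_div_unimodular.
by case: P_irr => /(_ (g i) (mem_nth _ (ltn_ord i)))[].
Qed.

(** Divisibility between irreducibles over the field gives a scalar multiple. By unimodularity the
    scalar amounts to a unit of [R], so the two are associated in [R[x]]. *)
Lemma irr_div_frac_dvdp i j : gK i %| gK j -> i = j.
Proof.
move=> g_ij; case: P_irr => _ _; apply.
have [i_gt1 _] := irr_div_frac_irreducible i.
have /eqpf_eq[c c0 gE] : gK i %= gK j.
  by apply: (apply_irredp (irr_div_frac_irreducible j)) => //; rewrite neq_ltn i_gt1 orbT.
have [u [uU ->]] :=
  frac_unimodular_assoc (irr_div_unimodular i) (irr_div_unimodular j) gE.
exists u%:P; rewrite mul_polyC; split=> //.
by apply/unitIn_polyP; exists u.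
Qed.

Lemma frac_powprod a : (powprod g a)^F = powprod gK a.
Proof. exact: (rmorph_powprod (map_poly (@FracField.tofrac R))). Qed.

Lemma frac_horner (h : {poly R}) a : h^F.[a%:F] = (h.[a])%:F.
Proof. exact: horner_map. Qed.

Lemma horner_powprod a x : (powprod g a).[x] = powprod (fun i => (g i).[x]) a.
Proof. exact: (rmorph_powprod (horner_eval x)). Qed.

(** Divisors of [f] are unimodular, so their nonunit factors are nonconstant and induction on the
    degree applies. *)
Lemma divisor_powprod h : dvdIn (@allR _) h f ->
  exists a c, c \is a GRing.unit /\ h = c *: powprod g a.
Proof.
have [k] := ubnP (size h); elim: k h => // k IH h lt_k hf.
have hU : unimodular h by case: hf => q [_ fE]; apply: (@unimodularMl _ q); rewrite -fE.
have [/unitIn_polyP[u [uU ->]]|hN] := classic (unitIn (@allR _) h).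
  by exists (fun=> 0%N), u; rewrite powprod0 alg_polyC.
have [h_irr|hR] := classic (irredIn (@allR _) h).
  case: P_irr => _ /(_ _ h_irr hf)[i [w [/unitIn_polyP[u [uU ->]] ->]]] _.
  by exists (fun j => (j == i) : nat), u; rewrite powprod_delta mul_polyC.
have [y [z [hE yN zN]]] : exists y z, [/\ h = y * z, ~ unitIn (@allR _) y
    & ~ unitIn (@allR _) z].
  apply: NNPP => hNN; apply: hR; split=> //; first exact: unimodular_neq0.
  move=> y z _ _ hE.
  apply: NNPP => /not_or_and[yN zN]; apply: hNN.
  by exists y, z.
have yU : unimodular y by apply: (@unimodularMl _ z); rewrite -hE.
have zU : unimodular z by apply: (@unimodularMl _ y); rewrite mulrC -hE.
have sy := unimodular_nonconst yU yN; have sz := unimodular_nonconst zU zN.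
have sh : size h = (size y + size z).-1 by rewrite hE size_mul ?unimodular_neq0.
have {}hf : exists q, f = h * q by case: hf => q [_ ->]; exists q.
have [||a [c [cU yE]]] := IH y; first by lia.
  by case: hf => q ->; exists (z * q); rewrite mulrA -hE.
have [||b [d [dU zE]]] := IH z; first by lia.
  by case: hf => q ->; exists (y * q); rewrite mulrA [z * y]mulrC -hE.
exists (fun i => a i + b i)%N, (c * d); rewrite unitrM cU dU; split=> //.
by rewrite hE yE zE powprodD -scalerAl -scalerAr scalerA.
Qed.

(** * Divisors of powers of [F] and the vanishing of fdk *)

Section Exponents.
Variables (n : nat) (m : 'I_(size P) -> nat) (c : R).
Hypothesis f_nonconst : (1 < size f)%N.
Hypothesis f_vd : vd_eq v f n.
Hypothesis n_gt0 : (0 < n)%N.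
Hypothesis f_notpower :
  forall (h : {poly R}) (k : nat), (2 <= k)%N -> ~ assocIn (@allR _) f (h ^+ k).
Hypothesis c_unit : c \is a GRing.unit.
Hypothesis fE : f = c *: powprod g m.

Local Notation F := ((p ^+ n)%:F^-1 *: f^F).

Let pF0 k : (p ^+ k)%:F != 0.
Proof. by rewrite tofrac_eq0 expf_neq0. Qed.

Lemma frac_powprod_inj d a b : powprod gK a = d *: powprod gK b -> a =1 b.
Proof.
move=> abE; apply: (powprod_inj irr_div_frac_irreducible irr_div_frac_dvdp _ abE).
apply/eqP => d0; move: (powprod_neq0 irr_div_frac_irreducible a).
by rewrite abE d0 scale0r eqxx.
Qed.

(** Factoring the cofactor of [g i] in [f] and multiplying back by [g i] gives a second exponent
    vector of [f], with a positive entry at [i]. *)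
Lemma exponent_gt0 i : (0 < m i)%N.
Proof.
case: P_irr => /(_ (g i) (mem_nth _ (ltn_ord i)))[_ [q [_ fq]]] _ _.
have [|a [d [dU qE]]] := @divisor_powprod q.
  by exists (g i); rewrite mulrC.
have: (c *: powprod g m)^F = (d *: powprod g (fun j => a j + (j == i))%N)^F.
  by rewrite -fE fq powprodD powprod_delta qE -scalerAr mulrC.
rewrite !map_polyZ !frac_powprod /= => /(congr1 (fun q => c%:F^-1 *: q)).
rewrite !scalerA mulVf ?unit_tofrac_neq0 // scale1r => /frac_powprod_inj/(_ i) ->.
by rewrite eqxx /= addn1.
Qed.

Lemma expF t : F ^+ t = ((c ^+ t)%:F / (p ^+ (t * n))%:F) *: powprod gK (fun i => t * m i)%N.
Proof.
rewrite {1}fE map_polyZ frac_powprod scalerA powprodX exprZn; congr (_ *: _).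
by rewrite exprMn exprVn -!tofracXn -exprM mulnC mulrC.
Qed.

(* This is where the hypothesis that [f] is not a proper power enters: with
   [n'] the denominator of [e / n] in lowest terms, all [m i] are divisible by [n']. *)
Lemma proportional_exponent a e : (forall i, n * a i = e * m i)%N ->
  exists t, e = (t * n)%N /\ forall i, a i = (t * m i)%N.
Proof.
move=> aE; pose d := gcdn n e; have d_gt0 : (0 < d)%N by rewrite gcdn_gt0 n_gt0.
pose n' := (n %/ d)%N; pose e' := (e %/ d)%N.
have nE : n = (n' * d)%N by rewrite divnK ?dvdn_gcdl.
have eE : e = (e' * d)%N by rewrite divnK ?dvdn_gcdr.
have co : coprime n' e'.
  rewrite /coprime -(eqn_pmul2r d_gt0) muln_gcdl -nE -eE mul1n //.
have n'm i : (n' %| m i)%N.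
  rewrite -(Gauss_dvdr _ co); apply/dvdnP; exists (a i).
  apply/eqP; rewrite -(eqn_pmul2r d_gt0) mulnAC -eE -aE.
  by rewrite -mulnA -nE mulnC.
have n'_gt0 : (0 < n')%N by rewrite divn_gt0 // dvdn_leq // dvdn_gcdl.
have n'1 : n' = 1%N.
  apply/eqP; rewrite eqn_leq n'_gt0 andbT leqNgt; apply/negP => n'_gt1.
  apply: (f_notpower (h := powprod g (fun i => m i %/ n')%N) n'_gt1).
  exists c%:P; split; first by apply/unitIn_polyP; exists c.
  rewrite mul_polyC -powprodX {1}fE; congr (_ *: _).
  by apply: eq_powprod => i; rewrite mulnC divnK.
exists e'; have nd : n = d by rewrite nE n'1 mul1n.
rewrite {1}eE -nd; split=> // i; apply/eqP.
by rewrite -(eqn_pmul2l n_gt0) aE {1}eE -nd mulnAC mulnC.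
Qed.

Lemma inW_horner_neq0 x i : inW v f n x -> (g i).[x] != 0.
Proof.
case=> fx0 _; apply: contraNneq fx0 => gx0.
case: P_irr => /(_ (g i) (mem_nth _ (ltn_ord i)))[_ [q [_ ->]]] _ _.
by rewrite hornerM gx0 mul0r.
Qed.

Lemma inW_val a x : inW v f n x ->
  v (powprod g a).[x] = (\sum_i a i * v (g i).[x])%N.
Proof. by move=> xW; rewrite horner_powprod dvr_val_prod // => i; apply: inW_horner_neq0. Qed.

Lemma inW_sum x : inW v f n x -> (\sum_i m i * v (g i).[x])%N = n.
Proof.
move=> xW; rewrite -inW_val //; case: (xW) => fx0 fxn.
move: fx0 fxn; rewrite fE hornerZ mulf_eq0 => /norP[c0 x0].
by rewrite dvr_valM // dvr_val_unit.
Qed.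

Lemma F_unit_at x : inW v f n x -> unit_at F x.
Proof.
case=> fx0 <-; case: p_dvr => _ _ /(_ _ fx0)[u [uU fxE]].
exists u; split=> //; rewrite hornerZ frac_horner {2}fxE tofracM mulrCA.
by rewrite mulVf ?mulr1 // pF0.
Qed.

Lemma IntR_div_pow k (h : {poly R}) : (forall x, exists y, h.[x] = p ^+ k * y) ->
  IntR ((p ^+ k)%:F^-1 *: h^F).
Proof.
move=> hk x; have [y hy] := hk x; exists y.
by rewrite hornerZ frac_horner hy tofracM mulKf.
Qed.

Lemma F_IntR : IntR F.
Proof.
apply: IntR_div_pow => x; apply: dvr_dvd_val => fx0.
by case: f_vd => _; apply.
Qed.

Lemma F_size : (1 < size F)%N.
Proof. by rewrite size_scale ?invr_eq0 ?pF0 // size_frac. Qed.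

Lemma divisor_of_fdk_zero : fdk_zero v f n P ->
  forall k x y, IntR x -> IntR y -> x * y = F ^+ k ->
    exists u t, u \is a GRing.unit /\ x = u%:F *: F ^+ t.
Proof.
move=> fdk0 k x y xI yI xyE.
have [|a [d [d0 xE]]] := @dvdp_powprodP _ _ gK irr_div_frac_irreducible x (fun i => k * m i)%N.
  have := dvdp_mulIl x y; rewrite xyE expF dvdpZr //.
  by rewrite mulf_neq0 ?invr_eq0 ?pF0 ?unit_tofrac_neq0 ?unitrX.
have xW z : inW v f n z -> exists u, u \is a GRing.unit /\ d * (powprod g a).[z]%:F = u%:F.
  move=> zW; have [|u [uU xu]] := @unit_atMl x y z xI yI.
    by rewrite xyE; apply: unit_at_exp; apply: F_unit_at.
  by exists u; rewrite -xu xE -frac_powprod hornerZ frac_horner.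
case: f_vd => -[z0 z0W] _; have [u0 [u0U z0E]] := xW _ z0W.
(* The value at the reference point [z0] will be the constant valuation on W(f). *)
pose e := v (powprod g a).[z0].
have aW_neq0 z : inW v f n z -> (powprod g a).[z] != 0.
  case/xW=> u [/unit_tofrac_neq0 uF zE]; apply: contraNneq uF => z_0.
  by rewrite -zE z_0 rmorph0 mulr0.
have [w [wU wE]] : exists w, w \is a GRing.unit /\ (powprod g a).[z0] = w * p ^+ e.
  by case: p_dvr => _ _; apply; apply: aW_neq0.
have eW z : inW v f n z -> (\sum_i a i * v (g i).[z])%N = e.
  move=> zW; rewrite -inW_val //; have [u [uU zE]] := xW _ zW.
  (* The scalar [d] lies in the fraction field, where [v] is not defined; cross-multiplying the
     values at [z] and [z0] eliminates it. *)
  have /eqP : (u%:F * (powprod g a).[z0]%:F) = (u0%:F * (powprod g a).[z]%:F).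
    by rewrite -zE -z0E mulrAC.
  rewrite -!tofracM tofrac_eq => /eqP /(congr1 v).
  have u_0 : u != 0 by rewrite -tofrac_eq0 unit_tofrac_neq0.
  have u0_0 : u0 != 0 by rewrite -tofrac_eq0 unit_tofrac_neq0.
  by rewrite !dvr_valM ?aW_neq0 // (dvr_val_unit uU) (dvr_val_unit u0U) !add0n.
(* The vector with entries [n * a i - e * m i] lies in fdk(f): on W(f) its two parts sum to [n * e]
   and [e * n]. *)
have aE i : (n * a i = e * m i)%N.
  apply/eqP; rewrite -(eqr_nat rat) -subr_eq0; apply/eqP.
  apply: (fdk0 (fun i => (n * a i)%:R - (e * m i)%:R)) => z zW.
  transitivity ((n * \sum_i a i * v (g i).[z])%:R - (e * \sum_i m i * v (g i).[z])%:R : rat).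
    rewrite !big_distrr /= !natr_sum -sumrB; apply: eq_bigr => j _.
    by rewrite mulrBl -!natrM !mulnA.
  by rewrite eW // inW_sum // mulnC subrr.
have [t [eE atE]] := proportional_exponent aE.
(* The value at [z0] gives [d * w * p ^+ e = u0] with [e = t * n], while [F ^+ t] carries the scalar
   [c ^+ t / p ^+ (t * n)]. *)
exists (u0 / w / c ^+ t), t; split; first by rewrite !unitrM !unitrV u0U wU unitrX.
rewrite xE expF (eq_powprod _ atE) scalerA; congr (_ *: _).
rewrite wE eE tofracM in z0E.
have [wF0 cF0] := (unit_tofrac_neq0 wU, unit_tofrac_neq0 (unitrX t c_unit)).
rewrite !tofracM -z0E !rmorphV ?unitrX //=.
by rewrite mulrA divfK // [w%:F * _]mulrC mulrA mulfK // mulfK.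
Qed.

(* Off [W] the value [f.[x]] has valuation at least [n + 1], and this excess
   pays for the perturbation of the exponents. *)
Lemma powprod_IntR b N l :
  (forall x, inW v f n x -> (\sum_i b i * v (g i).[x])%N = (N * n)%N) ->
  (forall i, l * m i <= b i)%N -> (N * n <= l * n.+1)%N ->
  IntR ((p ^+ (N * n))%:F^-1 *: (powprod g b)^F).
Proof.
move=> bW lb le_l; apply: IntR_div_pow => x.
have [xW|xNW] := classic (inW v f n x).
  by apply: dvr_dvd_val => _; rewrite inW_val // bW.
have [y fy] : exists y, f.[x] = p ^+ n.+1 * y.
  apply: dvr_dvd_val => fx0; case: f_vd => _ /(_ _ fx0).
  by rewrite leq_eqVlt => /orP[/eqP nE|//]; case: xNW.
(* Split off [l] full copies of [f], each divisible by [p ^+ n.+1] at [x]. *)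
have bE : b =1 (fun i => l * m i + (b i - l * m i))%N by move=> i; rewrite subnKC.
have mE : powprod g m = c^-1 *: f by rewrite fE scalerA mulVr // scale1r.
rewrite (eq_powprod _ bE) powprodD powprodX hornerM horner_exp mE hornerZ fy.
exists (p ^+ (l * n.+1 - N * n) * (c^-1 * y) ^+ l * (powprod g (fun i => b i - l * m i)%N).[x]).
rewrite [c^-1 * (_ * _)]mulrCA exprMn -exprM [(n.+1 * l)%N]mulnC.
by rewrite -{1}(subnKC le_l) exprD !mulrA.
Qed.

Lemma fdk_zero_of_divisor :
  (forall k x y, IntR x -> IntR y -> x * y = F ^+ k ->
    exists u t, u \is a GRing.unit /\ x = u%:F *: F ^+ t) -> fdk_zero v f n P.
Proof.
move=> F_div u uW i.
(* Clear denominators: [z] is the integral vector [M * u]. *)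
pose M := \prod_j denq (u j).
pose z j := numq (u j) * \prod_(k | k != j) denq (u k).
have zE j : (z j)%:~R = M%:~R * u j :> rat.
  by rewrite /M (bigD1 j) //= /z !intrM numqE mulrC mulrA mulrAC [RHS]mulrAC [in RHS]mulrC mulrA.
have zW x : inW v f n x -> \sum_j z j * (v (g j).[x])%:Z = 0.
  move=> xW; apply: (@intr_inj rat); rewrite rmorph_sum rmorph0 /=.
  transitivity (M%:~R * \sum_(j < size P) u j * (v (g j).[x])%:R : rat).
    rewrite mulr_sumr; apply: eq_bigr => j _.
    by rewrite intrM zE mulrA.
  by rewrite uW // mulr0.
(* [U] bounds every entry of [z], so [N * m j + z j] and [N * m j - z j] are at least
   [(N - U) * m j]. The choice of [N] makes [(N - U) * n.+1] exactly [N * n], as integrality off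
   W(f) requires. *)
pose U := (\sum_j `|z j|)%N; pose N := (U * n.+1)%N.
have zU j : (`|z j| <= U * m j)%N.
  apply: (@leq_trans U); last by rewrite leq_pmulr ?exponent_gt0.
  by rewrite /U (bigD1 j) //= leq_addr.
have UN : (U <= N)%N by rewrite leq_pmulr.
(* The absolute values only return to natural numbers; [zN] shows that both integers are
   nonnegative. *)
pose b j := `|((N * m j)%N%:Z + z j)%R|%N; pose b' j := `|((N * m j)%N%:Z - z j)%R|%N.
have zN j : (`|z j| + (N - U) * m j <= N * m j)%N.
  by rewrite -{2}(subnK UN) mulnDl addnC leq_add2l.
have bE j : (b j)%:Z = (N * m j)%N%:Z + z j by rewrite /b; have := zN j; lia.
have b'E j : (b' j)%:Z = (N * m j)%N%:Z - z j by rewrite /b'; have := zN j; lia.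
have bW x : inW v f n x -> (\sum_j b j * v (g j).[x])%N = (N * n)%N.
  move=> xW; apply/eqP; rewrite -eqz_nat; apply/eqP.
  rewrite -(inW_sum xW) big_distrr /= -[LHS]natz -[RHS]natz !natr_sum.
  rewrite -[RHS]addr0 -[X in _ = _ + X](zW x xW) -big_split /=; apply: eq_bigr => j _.
  by rewrite !natz !PoszM bE mulrDl mulrA PoszM.
have b'W x : inW v f n x -> (\sum_j b' j * v (g j).[x])%N = (N * n)%N.
  move=> xW; apply/eqP; rewrite -eqz_nat; apply/eqP.
  rewrite -(inW_sum xW) big_distrr /= -[LHS]natz -[RHS]natz !natr_sum.
  rewrite -[RHS]subr0 -[X in _ = _ - X](zW x xW) -sumrB /=; apply: eq_bigr => j _.
  by rewrite !natz !PoszM b'E mulrBl mulrA PoszM.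
have le_N : (N * n <= (N - U) * n.+1)%N.
  by rewrite mulnBl mulnS /N -/N addKn.
have bI : IntR ((p ^+ (N * n))%:F^-1 *: (powprod g b)^F).
  apply: (powprod_IntR bW _ le_N) => j.
  by have := zN j; have := bE j; lia.
have b'I : IntR ((p ^+ (N * n))%:F^-1 *: (powprod g b')^F).
  apply: (powprod_IntR b'W _ le_N) => j.
  by have := zN j; have := b'E j; lia.
(* The exponents [b] and [b'] add up to [2 * N * m]; the factor [c ^+ (2 * N)] restores the unit by
   which [f] differs from [powprod g m]. *)
have [|w [t [wU xE]]] := F_div (2 * N)%N _ _ (IntRZ (c ^+ (2 * N)) bI) b'I.
  rewrite expF // -!frac_powprod scalerA -scalerAl -scalerAr scalerA -rmorphM /=.
  rewrite -powprodD (eq_powprod g (b := fun j => (2 * N) * m j)%N); last first.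
    by move=> j; have := bE j; have := b'E j; lia.
  congr (_ *: _); rewrite -mulrA -invfM -tofracM -exprD.
  by rewrite -mulnDl addnn -mul2n.
move: xE; rewrite expF // !frac_powprod !scalerA => xE.
have bt : b =1 (fun j => t * m j)%N.
  set d := (X in X *: powprod gK b = _) in xE.
  have d0 : d != 0.
    by rewrite mulf_neq0 ?invr_eq0 ?pF0 ?unit_tofrac_neq0 ?unitrX.
  move/(congr1 (fun q => d^-1 *: q)): xE.
  by rewrite !scalerA mulVf // scale1r => /frac_powprod_inj.
case: f_vd => -[x0 x0W] _.
(* At a point of W(f) the weighted sum of [b] is [N * n], and that of [t * m] is [t * n]. *)
have tN : t = N.
  apply/eqP; rewrite -(eqn_pmul2r n_gt0) -(bW _ x0W) -{1}(inW_sum x0W) big_distrr /=.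
  by apply/eqP/eq_bigr => j _; rewrite bt mulnA.
have z0 : z i = 0 by have := bE i; rewrite bt tN; lia.
have /eqP := zE i; rewrite z0 eq_sym mulf_eq0 intr_eq0 => /orP[|/eqP//].
by rewrite prodf_seq_eq0 => /hasP[j _ /=]; rewrite denq_eq0.
Qed.

End Exponents.
End IrreducibleDivisors.
End DVR.

Theorem theorem2 (R : idomainType) (p : R) (v : R -> nat)
    (f : {poly R}) (n : nat) (P : seq {poly R}) :
  dvr p v -> finite_residue p ->
  primitive f -> (1 < size f)%N ->
  vd_eq v f n -> (0 < n)%N ->
  (forall (h : {poly R}) (k : nat), (2 <= k)%N -> ~ assocIn (@allR _) f (h ^+ k)) ->
  irr_div_set f P ->
  (abs_irredIn (@IntR R)
     (((FracField.tofrac (p ^+ n))^-1) *: map_poly (@FracField.tofrac R) f)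
   <-> fdk_zero v f n P).
Proof.
move=> p_dvr _ f_prim f_nonconst f_vd n_gt0 f_notpower P_irr.
have f_unimod := primitive_unimodular p_dvr f_prim.
(* The factorization of [f] is the case of [f] as a divisor of itself. *)
have [|m [c [c_unit fE]]] := divisor_powprod p_dvr f_unimod P_irr (h := f).
  by exists 1; rewrite mulr1.
have [x0 x0W] := f_vd.1.
apply: iff_trans (abs_irredIn_divisorsP p_dvr (F_IntR p_dvr f_vd)
  (F_unit_at p_dvr x0W) (F_size p_dvr n f_nonconst)) _.
split; last exact: divisor_of_fdk_zero fE.
exact: fdk_zero_of_divisor fE.
Qed.
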